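(* Let $T$ be a tree of order $n\ge 2$ with exactly $p\ge 3$ pendent vertices (leaves). Then $$\mathrm{aecc}_3(T)\ge \mathrm{aecc}_3(BS_{n,p}).$$
   Context: For a connected graph $G$ with $n(G)$ vertices and $S\subseteq V(G)$, the Steiner distance $d_G(S)$ is the minimum number of edges of a connected subgraph of $G$ containing $S$. For $v\in V(G)$, $\mathrm{ecc}_3(v,G)=\max\{d_G(S): v\in S\subseteq V(G), |S|=3\}$, and $\mathrm{aecc}_3(G)=\frac{1}{n(G)}\sum_{v\in V(G)}\mathrm{ecc}_3(v,G)$. A starlike tree is a tree with exactly one vertex of degree at least three, i.e. a tree obtained by attaching $t\ge 3$ pendent paths (each of length at least 1) to a single vertex; it is balanced if the lengths of these pendent paths pairwise differ by at most one. $BS_{n,p}$ denotes the (unique up to isomorphism) balanced starlike tree of order $n$ with $p$ leaves. *)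

(* Defs.v *)
From HB Require Import structures.
From mathcomp Require Import all_boot all_order all_algebra.
Import Order.TTheory GRing.Theory Num.Theory.

Set Implicit Arguments.
Unset Strict Implicit.
Unset Printing Implicit Defensive.

Record sgraph := SGraph {
  vert :> finType;
  adj : rel vert;
  adj_sym : symmetric adj;
  adj_irr : irreflexive adj }.

Definition edges (G : sgraph) : {set {set G}} :=
  [set [set u.1; u.2] | u : G * G & adj u.1 u.2].

Definition degree (G : sgraph) (v : G) : nat := #|[set w | adj v w]|.

Definition leaves (G : sgraph) : {set G} := [set v | degree v == 1].

Definition connected (G : sgraph) : Prop :=
  forall x y : G, connect (@adj G) x y.

(* A cycle is listed by its vertices; closed walks of length at most 2 are
   not cycles of a simple graph. *)
Definition acyclic (G : sgraph) : Prop :=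
  forall c : seq G, ucycle (@adj G) c -> size c <= 2.

Definition is_tree (G : sgraph) : Prop :=
  0 < #|G| /\ connected G /\ acyclic G.

Definition isomorphic (G H : sgraph) : Prop :=
  exists2 f : G -> H, bijective f & forall x y, adj (f x) (f y) = adj x y.

(* The pair (W, F) stands for the subgraph with vertex set W and edge set F. *)
Definition connected_subgraph (G : sgraph)
    (H : {set G} * {set {set G}}) : bool :=
  [&& H.2 \subset edges G,
      [forall f in H.2, f \subset H.1] &
      [forall x in H.1, forall y in H.1,
         connect [rel u v | [set u; v] \in H.2] x y]].

(* When G is connected, G itself is one of the subgraphs considered, so that
   the default value #|edges G| does not affect the minimum. *)
Definition steiner_dist (G : sgraph) (S : {set G}) : nat :=
  \big[minn/#|edges G|]_(H : {set G} * {set {set G}} |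
      connected_subgraph H && (S \subset H.1)) #|H.2|.

Definition ecc3 (G : sgraph) (v : G) : nat :=
  \max_(S : {set G} | (v \in S) && (#|S| == 3)) steiner_dist S.

Definition aecc3 (G : sgraph) : rat :=
  ((\sum_(v : G) (ecc3 v)%:R) / #|G|%:R)%R.

(* Attaching t pendent paths of lengths l 0, ..., l (t-1) to one vertex: None
   is that vertex, and Some (Tagged _ j), with tag i, is the vertex at
   distance j + 1 from it on the i-th path. *)
Definition spider_vert (t : nat) (l : 'I_t -> nat) : finType :=
  option {i : 'I_t & 'I_(l i)}.

Definition spider_adj (t : nat) (l : 'I_t -> nat) : rel (spider_vert l) :=
  fun x y => match x, y with
  | None, None => false
  | None, Some u | Some u, None => tagged u == 0 :> nat
  | Some u, Some v =>
      (tag u == tag v) &&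
      (((tagged u).+1 == tagged v :> nat) || ((tagged v).+1 == tagged u :> nat))
  end.

Lemma spider_adj_sym t (l : 'I_t -> nat) : symmetric (@spider_adj t l).
Proof. by case=> [u|] [v|] //=; rewrite eq_sym orbC. Qed.

Lemma spider_adj_irr t (l : 'I_t -> nat) : irreflexive (@spider_adj t l).
Proof. by case=> [u|] //=; rewrite orbb gtn_eqF // andbF. Qed.

Definition spider (t : nat) (l : 'I_t -> nat) : sgraph :=
  SGraph (@spider_adj_sym t l) (@spider_adj_irr t l).

Definition balanced_starlike (G : sgraph) : Prop :=
  exists (t : nat) (l : 'I_t -> nat),
    [/\ 3 <= t, forall i, 0 < l i, forall i j, l i <= (l j).+1 &
        isomorphic G (spider l)].

(* G is (a copy of) BS_{n,p}. *)
Definition is_BS (n p : nat) (G : sgraph) : Prop :=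
  [/\ balanced_starlike G, #|G| = n & #|leaves G| = p].

Lemma card_spider t (l : 'I_t -> nat) : #|spider l| = (\sum_i l i).+1.
Proof.
rewrite card_option card_tagged sumnE big_map big_enum /=.
by congr _.+1; apply: eq_bigr => i _; rewrite card_ord.
Qed.

Lemma card_leaves_spider t (l : 'I_t -> nat) :
  3 <= t -> (forall i, 0 < l i) -> #|leaves (spider l)| = t.
Proof.
move=> t3 l0.
pose V (i : 'I_t) j (h : j < l i) : spider l :=
  Some (@Tagged 'I_t i (fun i => 'I_(l i)) (Ordinal h)).
have VE i j k (h : j < l i) (h' : k < l i) : j = k -> V i j h = V i k h'.
  by move=> jk; subst k; rewrite (bool_irrelevance h h').
pose pos (x : spider l) : nat := if x is Some u then (tagged u).+1 else 0.
have lt_last i : (l i).-1 < l i by rewrite prednK.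
pose f i := V i _ (lt_last i).
have f_inj : injective f by move=> i j [].
have -> : #|leaves (spider l)| = #|codom f|; last first.
  by rewrite card_codom // card_ord.
have not_leaf (x y z : spider l) :
    y != z -> adj x y -> adj x z -> x \notin leaves (spider l).
  move=> yz xy xz; rewrite inE neq_ltn; apply/orP; right.
  rewrite (_ : 2 = #|[set y; z]|); last by rewrite cards2 yz.
  apply: subset_leq_card; apply/subsetP=> w.
  by rewrite !inE => /orP[] /eqP ->.
apply: eq_card => x; case: x => [[i [j h]]|]; last first.
  have t0 : 0 < t by exact: ltn_trans t3.
  have t1 : 1 < t by exact: ltn_trans t3.
  have := not_leaf None (V (Ordinal t0) 0 (l0 _)) (V (Ordinal t1) 0 (l0 _)).
  move=> H; rewrite (negbTE (H _ _ _)) //.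
  by apply/esym/negbTE/codomP=> -[k].
rewrite -/(V i j h).
have [pr [adj_pr pr_lo pr_uniq]] : exists y : spider l,
    [/\ adj (V i j h) y, (forall h', y != V i j.+1 h') &
      forall z, adj (V i j h) z ->
        z = y \/ exists h', z = V i j.+1 h'].
  have nxt (k : nat) (h1 : k < l i) : k = j.+1 ->
      exists h', V i k h1 = V i j.+1 h'.
    by move=> ek; subst k; exists h1.
  case: j h nxt => [|j] h nxt.
    exists None; split=> // -[[k [m hm]]|] /=; last by left.
    by move=> /andP[/eqP ik]; subst k => /orP[/eqP em|//]; right; apply: nxt.
  exists (V i j (ltnW h)); split=> /=; first by rewrite !eqxx orbT.
    move=> h'; apply/eqP=> /(congr1 pos) [] /eqP.
    by rewrite ltn_eqF.
  move=> [[k [m hm]]|//] /= /andP[/eqP ik]; subst k => /orP[/eqP em|].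
    by right; apply: nxt.
  by rewrite eqSS => /eqP em; left; apply: VE.
have [hS|lj] := ltnP j.+1 (l i).
  rewrite (negbTE (not_leaf _ _ (V i j.+1 hS) (pr_lo hS) adj_pr _)); last first.
    by rewrite /= !eqxx.
  apply/esym/negbTE/codomP=> -[k e]; have [ik _] := e; subst k.
  have [ej] := congr1 pos e.
  by move: hS; rewrite ej prednK // ltnn.
have ej : j = (l i).-1.
  by apply/eqP; rewrite eqn_leq -ltnS prednK // h -ltnS prednK.
have -> : V i j h \in codom f by rewrite (VE _ _ _ h (lt_last i) ej) codom_f.
rewrite inE; apply/cards1P; exists pr; apply/setP=> z; rewrite !inE.
apply/idP/eqP => [/pr_uniq[//|[h' _]]|->//].
by have := leq_trans h' lj; rewrite ltnn.
Qed.

Lemma is_BS_exists (n p : nat) : 3 <= p -> p < n -> exists G, is_BS n p G.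
Proof.
move=> p3 pn; have p0 : 0 < p by exact: ltn_trans p3.
pose q := n.-1 %/ p; pose r := n.-1 %% p.
pose l (i : 'I_p) := q + (i < r).
have n0 : 0 < n by exact: leq_ltn_trans pn.
have q0 : 0 < q by rewrite divn_gt0 // -ltnS prednK.
have l0 i : 0 < l i by rewrite addn_gt0 q0.
exists (spider l); split; last exact: card_leaves_spider.
  exists p, l; split=> //.
    by move=> i j; rewrite /l -addnS leq_add2l; case: (i < r).
  by exists id => //; exists id.
rewrite card_spider big_split /= sum_nat_const card_ord.
have rp : r <= p by rewrite ltnW // ltn_pmod.
rewrite -big_mkcond /= -(big_ord_widen _ (fun=> 1) rp) sum1_card card_ord.
by rewrite mulnC -divn_eq prednK.
Qed.

(* Main.v *)
(* Let P be a diametral path of T, from x to y and of length D; root T at x, so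
   that P consists of the ancestors of y. Write d(v) for the distance from v to
   P and h for its maximum, reached at z. The Steiner trees of {v, x, y},
   {v, y, z} and {v, x, z} give ecc_3(v) >= D + d(v) for every v, and
   ecc_3(v) >= max(D - j + h, j + h) for the vertex v of P at depth j. Hence
     sum ecc_3 >= n D + h (h + 1) + sum_(v off P) d(v).
   For each k > 0 at most p - 2 vertices are at distance k from P, as their
   branches end in distinct leaves off P. So, writing n - 1 = p q + r with
   r < p,
     sum_(v off P) d(v) + (p - 2) q (q + 1) / 2 >= (q + 1) (n - 1 - D),
   with equality for balanced branches, and n - 1 - D <= h (p - 2). Since
   2 h <= D as well, a convexity estimate shows that the resulting bound is
   smallest for the values of D and h found in BS_{n,p}. *)

Require Import Defs.
From mathcomp Require Import all_boot all_order all_algebra.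
From mathcomp Require Import zify.
Import Order.TTheory GRing.Theory Num.Theory.

Set Implicit Arguments.
Unset Strict Implicit.
Unset Printing Implicit Defensive.

(** * Steiner distances and paths in graphs *)

Lemma bigminn_le (I : eqType) (r : seq I) (P : pred I) (F : I -> nat) m i :
  i \in r -> P i -> \big[minn/m]_(j <- r | P j) F j <= F i.
Proof.
elim: r => // j r IHr; rewrite inE big_cons => /orP[/eqP <- Pi|ir Pi].
  by rewrite Pi geq_minl.
by case: ifP => _; rewrite ?geq_min IHr ?orbT.
Qed.

(** Pads a triple with possibly coinciding entries to a set of exactly three vertices, as [ecc3]
    requires. *)
Lemma superset_of_card (A : finType) (S : {set A}) k :
  #|S| <= k <= #|A| -> exists2 S' : {set A}, S \subset S' & #|S'| = k.
Proof.
elim: k => [|k IHk] /andP[Sk kA].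
  by exists S => //; apply/eqP; rewrite -leqn0.
have [eS|nS] := eqVneq #|S| k.+1; first by exists S.
have [|S' SS' cS'] := IHk; first by rewrite -ltnS ltn_neqAle nS Sk ltnW.
have /set0Pn[a aS'] : ~: S' != set0 by rewrite -card_gt0 cardsCs setCK cS' subn_gt0.
exists (a |: S'); first exact: subset_trans SS' (subsetUr _ _).
by move: aS'; rewrite inE cardsU1 cS' => ->.
Qed.

Lemma adj_edge (G : sgraph) (u v : G) : ([set u; v] \in edges G) = adj u v.
Proof.
apply/imsetP/idP => [[[a b]]|uv]; last first.
  by exists (u, v); rewrite ?inE.
rewrite inE /= => ab e.
have av : a \in [set u; v] by rewrite e set21.
have bv : b \in [set u; v] by rewrite e set22.
have /set2P[] : u \in [set a; b] by rewrite -e set21.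
all: have /set2P[] : v \in [set a; b] by rewrite -e set22.
all: move=> vE uE; subst u v; move: av bv; rewrite !in_set2 ?orbb => av bv.
- by move/eqP: bv => ba; move: ab; rewrite ba adj_irr.
- by [].
- by rewrite adj_sym.
by move/eqP: av => ba; move: ab; rewrite ba adj_irr.
Qed.

(** Since [par] leads from every vertex of [U] down to [x] with decreasing [dep], the vertices
    [x |: U] and the edges between u and [par u] form a connected subgraph with at most [#|U|]
    edges. *)
Lemma steiner_dist_le (G : sgraph) (x : G) (par : G -> G) (dep : G -> nat)
    (U S : {set G}) :
  (forall u, u \in U -> [/\ adj u (par u), par u \in x |: U & dep (par u) < dep u]) ->
  S \subset x |: U -> steiner_dist S <= #|U|.
Proof.
move=> hU SU; pose F := [set [set u; par u] | u in U].
apply: leq_trans (leq_imset_card (fun u => [set u; par u]) U).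
rewrite -/F -[#|F|]/((fun H : {set G} * {set {set G}} => #|H.2|) (x |: U, F)).
apply: bigminn_le; rewrite ?mem_index_enum // SU andbT.
have to_root u : u \in x |: U -> connect [rel u v | [set u; v] \in F] u x.
  have [k] := ubnP (dep u); elim: k u => // k IHk u uk.
  rewrite in_setU1 => /orP[/eqP-> //|uU]; have [_ pU lt_dep] := hU u uU.
  apply: connect_trans (connect1 _) (IHk _ (leq_trans lt_dep _) pU) => //.
  exact: imset_f.
apply/and3P; split.
- by apply/subsetP=> _ /imsetP[u uU ->]; rewrite adj_edge; case: (hU u uU).
- apply/forall_inP=> _ /imsetP[u uU ->]; have [_ pU _] := hU u uU.
  by rewrite subUset !sub1set pU inE uU orbT.
apply/forall_inP=> u uU; apply/forall_inP=> v vU.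
apply: connect_trans (to_root u uU) _; rewrite sym_connect_sym; first exact: to_root.
by move=> a b /=; rewrite setUC.
Qed.

(** Connectedness makes the whole graph one of the competing subgraphs, so the default value of the
    minimum obeys the same bound. *)
Lemma steiner_dist_ge (G : sgraph) (S : {set G}) k :
  connected G ->
  (forall H, connected_subgraph H -> S \subset H.1 -> k <= #|H.2|) ->
  k <= steiner_dist S.
Proof.
move=> Gc hk; apply: (big_ind (leq k)) => [|m n km kn|H /andP[]]; last exact: hk.
  apply: (hk (setT, edges G)) (subsetT _); apply/and3P; split=> //=.
    by apply/forall_inP=> f _; apply: subsetT.
  apply/forall_inP=> u _; apply/forall_inP=> v _.
  by rewrite (eq_connect (e' := @adj G)) // => a b /=; apply: adj_edge.
by rewrite leq_min km.
Qed.

(** A simple path from u to v avoiding this edge would close up with it to a cycle on at least three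
    vertices. *)
Lemma acyclic_bridge (G : sgraph) (u v : G) :
  acyclic G -> adj u v ->
  ~~ connect [rel a b | adj a b && ([set a; b] != [set u; v])] u v.
Proof.
move=> acG uv; apply/negP=> /connectP[p0 p0P ev].
case/shortenP: p0P ev => p pP up _ ev.
have /acG : ucycle (@adj G) (u :: p).
  rewrite /ucycle up andbT /= rcons_path -ev adj_sym uv andbT.
  by apply: sub_path pP => a b /andP[].
case: p pP up ev => [_ _ e|w [|a l] //= + _ e _]; last by rewrite e eqxx andbF.
by rewrite e adj_irr in uv.
Qed.

Lemma dist_exists (G : sgraph) : connected G -> exists d : G -> G -> nat,
  (forall u v, exists p, [/\ path (@adj G) u p, last u p = v & size p = d u v]) /\
  (forall u p, path (@adj G) u p -> d u (last u p) <= size p).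
Proof.
move=> Gc; pose Q u v k := [exists p : k.-tuple G, path (@adj G) u p && (last u p == v)].
have exQ u v : exists k, Q u v k.
  have /connectP[p pP ->] := Gc u v; exists (size p).
  by apply/existsP; exists (in_tuple p); rewrite pP eqxx.
exists (fun u v => ex_minn (exQ u v)); split=> u v => [|pP].
  case: ex_minnP => k /existsP[p /andP[pP /eqP pv]] _.
  by exists p; rewrite size_tuple.
case: ex_minnP => k _; apply; apply/existsP; exists (in_tuple v).
by rewrite pP eqxx.
Qed.

(** * Lower bound for trees *)

(** Here [dep] is the distance from [x], and a parent is any neighbour one step closer. It is
    unique: if w were another neighbour of u, no deeper than u, then both w and [par u] would reach
    [x] without the edge uw, which is a bridge. *)
Lemma tree_parent (G : sgraph) (x : G) (dep : G -> nat) :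
  acyclic G ->
  (forall u, exists p, [/\ path (@adj G) x p, last x p = u & size p = dep u]) ->
  (forall p, path (@adj G) x p -> dep (last x p) <= size p) ->
  exists par : G -> G,
    [/\ par x = x, forall u, dep (par u) = (dep u).-1,
        forall u, u != x -> adj u (par u) &
        forall u w, adj u w -> w = par u \/ u = par w].
Proof.
move=> acG dep_path dep_min.
have dep0 u : (dep u == 0) = (u == x).
  apply/eqP/eqP => [e|->]; last by apply/eqP; rewrite -leqn0 (dep_min [::]).
  by have [p [_ + +]] := dep_path u; rewrite e => <- /size0nil->.
have dep_adj u w : adj u w -> dep w <= (dep u).+1.
  have [p [pP pu <-]] := dep_path u => uw.
  by have := dep_min (rcons p w); rewrite last_rcons size_rcons rcons_path pP pu; apply.
have dep_pred u : u != x -> exists w, adj u w && ((dep w).+1 == dep u).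
  have [p] := dep_path u; case/lastP: p => [|p w] [pP <- sp]; first by rewrite eqxx.
  move: pP sp; rewrite last_rcons rcons_path size_rcons => /andP[pP pw] sp _.
  exists (last x p); rewrite adj_sym pw eqn_leq dep_adj // andbT -sp ltnS.
  exact: dep_min.
pose par u := if u == x then x else odflt x [pick w | adj u w && ((dep w).+1 == dep u)].
have parP u : u != x -> adj u (par u) && ((dep (par u)).+1 == dep u).
  move=> ux; rewrite /par (negbTE ux); case: pickP => //= noW.
  by have [w] := dep_pred u ux; rewrite noW.
have dep_par u : dep (par u) = (dep u).-1.
  have [->|/parP/andP[_ /eqP <-]//] := eqVneq u x.
  by rewrite /par eqxx; have /eqP-> : dep x == 0 by rewrite dep0.
have par_lo u w : adj u w -> dep w <= dep u -> w = par u.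
  move=> uw wu; apply/eqP; apply: contraT => w_par.
  have wu' : w != u by apply: contraTneq uw => ->; rewrite adj_irr.
  have ux : u != x.
    rewrite -dep0; apply: contraNneq wu' => u0; move: (wu).
    rewrite u0 leqn0 dep0 => /eqP->; by rewrite eq_sym -dep0 u0.
  have /andP[adj_par /eqP dpu] := parP u ux.
  pose e := [rel a b | adj a b && ([set a; b] != [set u; w])].
  have e_sym : connect_sym e.
    by apply: sym_connect_sym => a b; rewrite /= adj_sym setUC.
  (* All later vertices on the chain of parents from v are less deep than u, so the chain never
     meets u and avoids the edge uw. *)
  have to_x v : v != u -> dep v <= dep u -> connect e v x.
    have [k] := ubnP (dep v); elim: k v => // k IHk v vk vu v_le.
    have [->//|vx] := eqVneq v x.
    have /andP[avp /eqP dpv] := parP v vx.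
    have pvu : par v != u by apply: contraTneq v_le => <-; rewrite -dpv ltnn.
    apply: connect_trans (connect1 _) (IHk _ _ pvu _); first 1 last.
    - by rewrite -ltnS dpv.
    - by rewrite ltnW // dpv.
    rewrite /= avp; apply: contraTneq (set21 u w) => <-.
    by rewrite !inE negb_or ![u == _]eq_sym vu pvu.
  case/negP: (acyclic_bridge acG uw).
  apply: (@connect_trans _ _ (par u)).
    apply: connect1; rewrite /= adj_par; apply: contraTneq (set22 u w) => <-.
    by rewrite !inE negb_or wu' w_par.
  apply: (@connect_trans _ _ x); last by rewrite e_sym to_x.
  apply: to_x; last by rewrite -dpu.
  by apply: contraTneq adj_par => ->; rewrite adj_irr.
exists par; split=> // [|u /parP/andP[]//|u w uw]; first by rewrite /par eqxx.
case: (leqP (dep w) (dep u)) => wu; first by left; apply: par_lo.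
by right; apply: par_lo; rewrite 1?adj_sym // ltnW.
Qed.

Lemma card_disjointU (I : finType) (A B : {set I}) :
  [disjoint A & B] -> #|A :|: B| = #|A| + #|B|.
Proof. by move=> AB; apply/eqP; rewrite (leq_card_setU A B). Qed.

Lemma sum_subn_ord h m : h <= m.+1 -> 2 * (\sum_(j < m.+1) (h - j)) = h * h.+1.
Proof.
(* Strengthened for induction: the partial sum and the remaining triangular number have a constant
   total. *)
move=> hm; suff H k : 2 * (\sum_(j < k) (h - j)) + (h - k) * (h - k).+1 = h * h.+1.
  have := H m.+1; have -> : h - m.+1 = 0 by lia.
  by rewrite mul0n addn0.
elim: k => [|k IHk]; first by rewrite big_ord0 muln0 subn0.
rewrite big_ord_recr /= -IHk; case: (leqP h k) => hk.
  have [-> ->] : h - k = 0 /\ h - k.+1 = 0 by split; lia.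
  by rewrite addn0.
rewrite (_ : h - k = (h - k.+1).+1); last by lia.
by move: (\sum_(i < k) _) (h - k.+1) => a b; nia.
Qed.

(** * Ancestors and separating edges in a rooted tree *)

Section RootedTree.

Variables (G : sgraph) (x : G) (dep : G -> nat) (par : G -> G).
Hypothesis G_connected : connected G.
Hypothesis dep0 : forall u, (dep u == 0) = (u == x).
Hypothesis par_root : par x = x.
Hypothesis dep_par : forall u, dep (par u) = (dep u).-1.
Hypothesis adj_par : forall u, u != x -> adj u (par u).
Hypothesis par_adj : forall u w, adj u w -> w = par u \/ u = par w.

(* If dep v < dep u, the truncated exponent is 0 and the test v == u fails. *)
Definition anc (u v : G) := iter (dep v - dep u) par v == u.

Lemma dep_iter k v : dep (iter k par v) = dep v - k.
Proof. by elim: k => [|k IHk] /=; rewrite ?subn0 // dep_par IHk subnS. Qed.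

Lemma dep_parS v : v != x -> dep v = (dep (par v)).+1.
Proof. by rewrite -dep0 dep_par; case: (dep v). Qed.

Lemma anc_refl v : anc v v. Proof. by rewrite /anc subnn. Qed.

Lemma anc_dep u v : anc u v -> dep u <= dep v.
Proof. by move=> /eqP<-; rewrite dep_iter leq_subr. Qed.

Lemma anc_inj v : {in [pred u | anc u v] &, injective dep}.
Proof. by move=> u w /eqP uv /eqP wv e; rewrite -uv -wv e. Qed.

Lemma ancE u v : anc u v = (u == v) || anc u (par v).
Proof.
have [->|uv] := eqVneq u v; first exact: anc_refl.
apply/idP/idP => /= H; last first.
  have [vx|vx] := eqVneq v x; first by move: H; rewrite vx par_root.
  have := anc_dep H; move: H; rewrite /anc (dep_parS vx) => H le.
  by rewrite subSn // iterSr.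
have uv' : dep u < dep v.
  rewrite ltn_neqAle anc_dep // andbT; apply: contra_neq uv => e.
  by move/eqP: H; rewrite e subnn.
move: H; rewrite /anc -(ltn_predK uv') subSn ?iterSr ?dep_par //.
by move: uv'; case: (dep v).
Qed.

Lemma anc_trans v u w : anc u v -> anc v w -> anc u w.
Proof.
move=> uv vw; have le1 := anc_dep uv; have le2 := anc_dep vw.
rewrite /anc; have -> : dep w - dep u = (dep v - dep u) + (dep w - dep v) by lia.
by rewrite iterD (eqP vw).
Qed.

Lemma anc_par v : anc (par v) v.
Proof. by rewrite ancE anc_refl orbT. Qed.

Lemma anc_root v : anc x v.
Proof.
rewrite /anc; have -> : dep x = 0 by apply/eqP; rewrite dep0.
by rewrite -dep0 dep_iter subn0 subnn.
Qed.

Lemma anc_of_root u : anc u x -> u = x.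
Proof.
move=> /anc_dep; have -> : dep x = 0 by apply/eqP; rewrite dep0.
by rewrite leqn0 dep0 => /eqP.
Qed.

(** The ancestors of v form the path from the root to v, with one vertex at each depth up to
    [dep v]. *)
Lemma sum_anc v (F : nat -> nat) :
  \sum_(u | anc u v) F (dep u) = \sum_(j < (dep v).+1) F j.
Proof.
rewrite (reindex_onto (fun j : 'I_(dep v).+1 => iter (dep v - j) par v)
  (fun u => inord (dep u))) /=; last first.
  by move=> u uv; rewrite inordK ?ltnS ?anc_dep //; apply/eqP.
have depE (j : 'I_(dep v).+1) : dep (iter (dep v - j) par v) = j.
  by rewrite dep_iter subKn // -ltnS.
apply: eq_big => [j|j _]; last by rewrite depE.
by rewrite /anc depE eqxx; apply/eqP/val_inj; rewrite /= inordK ?depE.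
Qed.

Lemma card_anc v : #|[set u | anc u v]| = (dep v).+1.
Proof.
by rewrite -sum1_card (eq_bigl (fun u => anc u v)) => [|u];
  rewrite ?inE // (sum_anc v (fun=> 1)) sum1_card card_ord.
Qed.

(* A path in H from s to t leaves the set of descendants of u, and the only
   edge of G that does so is {u, par u}. *)
Lemma edge_of_separated u s t (H : {set G} * {set {set G}}) :
  connected_subgraph H -> s \in H.1 -> t \in H.1 -> anc u s -> ~~ anc u t ->
  [set u; par u] \in H.2.
Proof.
case/and3P=> HE _ /forall_inP Hc sH tH us; apply: contraNT => uH.
have /forall_inP/(_ t tH) st := Hc s sH.
have cl : closed [rel a b | [set a; b] \in H.2] [pred w | anc u w].
  have cl1 a : [set a; par a] \in H.2 -> anc u a = anc u (par a).
    move=> aH; rewrite ancE; have [ua|//] := eqVneq u a.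
    by move: uH; rewrite ua aH.
  move=> a b /= abH; rewrite !inE.
  have := subsetP HE _ abH; rewrite adj_edge => /par_adj[]e; move: abH; rewrite e.
    exact: cl1.
  by rewrite setUC => /cl1.
by have := closed_connect cl st; rewrite !inE us => <-.
Qed.

(** For each u in [U], the edge from u to its parent separates two of the chosen vertices, so every
    connected subgraph containing them uses it; different u give different edges. *)
Lemma ecc3_ge v a b (U : {set G}) :
  2 < #|G| ->
  (forall u, u \in U -> exists s t,
    [/\ s \in [set v; a; b], t \in [set v; a; b], anc u s & ~~ anc u t]) ->
  #|U| <= ecc3 v.
Proof.
move=> G3 hU; have [|S vabS cS] := @superset_of_card _ [set v; a; b] 3.
  rewrite G3 andbT (leq_trans (leq_card_setU _ _)) // cards1 cards2.
  by case: (v != a).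
have vS : v \in S by apply: (subsetP vabS); rewrite !inE eqxx.
apply: leq_trans (_ : steiner_dist S <= _); last first.
  by rewrite /ecc3 (bigD1 S) /= ?vS ?cS // leq_maxl.
apply: steiner_dist_ge => // H Hc SH.
pose f u := [set u; par u].
have U0 u : u \in U -> u != x.
  move=> /hU[s [t [_ _ _]]]; apply: contra => /eqP->; exact: anc_root.
rewrite -(card_in_imset (f := f)) => [|u w uU wU].
  apply/subset_leq_card/subsetP=> _ /imsetP[u /hU[s [t [sV tV us ut]]] ->].
  by apply: (edge_of_separated Hc _ _ us ut); apply/(subsetP SH)/(subsetP vabS).
(* If two of these edges coincided, each of u and w would be the parent of the other, contradicting
   their depths. *)
rewrite /f => e; apply/eqP; apply: contraT => uw.
have : u \in [set w; par w] by rewrite -e set21.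
have : w \in [set u; par u] by rewrite e set21.
rewrite !inE (negbTE uw) [w == u]eq_sym (negbTE uw) /= => /eqP wE /eqP uE.
have := dep_parS (U0 u uU); have := dep_parS (U0 w wU).
by rewrite -wE -uE => -> /eqP; rewrite -[X in X == _]addn0 -addn2 eqn_add2l.
Qed.

(** * Branches off the path from the root to a vertex *)

Section Trunk.

Variable y : G.

(** The distance from v to the path from [x] to [y], counted by the ancestors of v that lie off this
    path. *)
Definition height v := #|[set u | anc u v && ~~ anc u y]|.

Lemma height_on v : anc v y -> height v = 0.
Proof.
move=> vy; apply: eq_card0 => u; rewrite !inE.
by apply/andP=> -[uv /negP]; apply; apply: anc_trans uv vy.
Qed.

Lemma off_neq_root v : ~~ anc v y -> v != x.
Proof. by apply: contraNneq => ->; apply: anc_root. Qed.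

Lemma height_off v : ~~ anc v y -> height v = (height (par v)).+1.
Proof.
move=> vy; rewrite /height.
have -> : [set u | anc u v && ~~ anc u y] =
    v |: [set u | anc u (par v) && ~~ anc u y].
  apply/setP=> u; rewrite !inE ancE.
  by have [->|] := eqVneq u v; rewrite //= vy.
rewrite cardsU1 !inE (_ : anc v (par v) = false) //.
apply/negP=> /anc_dep; by rewrite (dep_parS (off_neq_root vy)) ltnn.
Qed.

Lemma height_gt0 v : (0 < height v) = ~~ anc v y.
Proof. by case: (boolP (anc v y)) => [/height_on|/height_off] ->. Qed.

(** Along an edge, twice the height minus the depth changes by at most one. For a shortest path
    ending at [y] this will bound twice the height by the depth. *)
Lemma path_height a p : path (@adj G) a p ->
  2 * height a + dep (last a p) <= 2 * height (last a p) + dep a + size p.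
Proof.
elim: p a => [|b p IHp] a /=; first by rewrite addn0.
case/andP=> ab /IHp; suff: 2 * height a + dep b <= 2 * height b + dep a + 1 by lia.
have step c : c != x ->
    [/\ 2 * height c + dep (par c) <= 2 * height (par c) + dep c + 1 &
        2 * height (par c) + dep c <= 2 * height c + dep (par c) + 1].
  move=> /dep_parS->; case: (boolP (anc c y)) => [cy|/height_off->]; last by split; lia.
  rewrite (height_on cy) (height_on (anc_trans (anc_par c) cy)); split; lia.
have [e|e] := par_adj ab; rewrite e in ab *.
  have ax : a != x by apply: contraTneq ab => ->; rewrite par_root adj_irr.
  by case: (step a ax).
have bx : b != x by apply: contraTneq ab => ->; rewrite par_root adj_irr.
by case: (step b bx).
Qed.

Lemma height_anc v l : anc v l -> ~~ anc v y ->
  height l + dep v = height v + dep l.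
Proof.
have [k] := ubnP (dep l); elim: k l => // k IHk l lk vl vy.
move: (vl); rewrite ancE => /orP[/eqP-> //|vpl].
have ly : ~~ anc l y by apply: contra vy; apply: anc_trans.
have e := dep_parS (off_neq_root ly); rewrite e ltnS in lk.
by rewrite height_off // e addSn (IHk _ lk vpl vy) addnS.
Qed.

(** A deepest descendant of v has no child, hence is a leaf. *)
Lemma leaf_above v : ~~ anc v y ->
  exists l, [/\ l \in leaves G, anc v l & ~~ anc l y].
Proof.
move=> vy; case: (@arg_maxnP _ v (anc v) dep (anc_refl v)) => l vl l_max.
have ly : ~~ anc l y by apply: contra vy; apply: anc_trans.
exists l; split=> //; rewrite inE; apply/cards1P; exists (par l).
apply/setP=> w; rewrite !inE; apply/idP/eqP => [lw|->]; last first.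
  exact/adj_par/off_neq_root.
case: (par_adj lw) => // lE.
have wx : w != x by apply: contraTneq lw => e; rewrite lE e par_root adj_irr.
have : dep w <= dep l by apply: l_max; rewrite ancE -lE vl orbT.
by rewrite (dep_parS wx) -lE ltnn.
Qed.

(** Each vertex at height k is sent to a leaf above it. This is injective: off the path height and
    depth grow together, so two ancestors of one leaf at equal height have equal depth and
    coincide. *)
Lemma card_level k : 0 < k ->
  #|[set v | height v == k]| <= #|[set l in leaves G | ~~ anc l y]|.
Proof.
move=> k0; pose P v l := [&& l \in leaves G, anc v l & ~~ anc l y].
pose f v := odflt v [pick l | P v l].
have fP v : height v == k -> P v (f v).
  move=> /eqP vk; rewrite /f; case: pickP => //= noP.
  have [|l [l1 l2 l3]] := @leaf_above v; first by rewrite -height_gt0 vk.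
  by have := noP l; rewrite /P l1 l2 l3.
rewrite -(@card_in_imset _ _ f) => [|v w].
  apply/subset_leq_card/subsetP=> _ /imsetP[v + ->]; rewrite !inE => /fP/and3P[].
  by rewrite inE => -> _ ->.
rewrite !inE => vk wk e; have /and3P[_ vl _] := fP v vk; have /and3P[_ wl _] := fP w wk.
rewrite -e in wl; apply: (anc_inj vl wl).
have := height_anc vl; have := height_anc wl.
rewrite -!height_gt0 (eqP vk) (eqP wk) k0 => /(_ isT) + /(_ isT); lia.
Qed.

Lemma card_anc_off_root v : #|[set u | anc u v && (u != x)]| = dep v.
Proof.
have := cardsD1 x [set u | anc u v]; rewrite card_anc inE anc_root => -[->].
by apply: eq_card => u; rewrite !inE andbC.
Qed.

Lemma ecc3_ge_diameter v : 2 < #|G| -> dep y + height v <= ecc3 v.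
Proof.
move=> G3; set U1 := [set u | anc u y && (u != x)].
set U2 := [set u | anc u v && ~~ anc u y].
have dU : [disjoint U1 & U2].
  rewrite disjoint_subset; apply/subsetP=> u; rewrite !inE => /andP[-> _].
  by rewrite andbF.
rewrite -(card_anc_off_root y) -/U1 /height -/U2 -card_disjointU //.
apply: (@ecc3_ge v x y) => // u; rewrite !inE => /orP[] /andP[us ux].
  by exists y, x; rewrite !inE !eqxx !orbT; split=> //; apply: contra ux => /anc_of_root->.
exists v, y; rewrite !inE !eqxx !orbT; split=> //.
Qed.

Lemma ecc3_ge_branch_y v z : 2 < #|G| -> anc v y ->
  (dep y - dep v) + height z <= ecc3 v.
Proof.
move=> G3 vy; set U1 := [set u | anc u y] :\: [set u | anc u v].
have cU1 : #|U1| = dep y - dep v.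
  rewrite cardsD (setIidPr _) ?card_anc //.
  by apply/subsetP=> u; rewrite !inE => /anc_trans; apply.
set U2 := [set u | anc u z && ~~ anc u y].
have dU : [disjoint U1 & U2].
  rewrite disjoint_subset; apply/subsetP=> u; rewrite !inE => /andP[_ ->].
  by rewrite andbF.
rewrite -cU1 /height -/U2 -card_disjointU //.
apply: (@ecc3_ge v y z) => // u; rewrite !inE => /orP[] /andP[u1 u2].
  by exists y, v; rewrite !inE !eqxx !orbT.
by exists z, y; rewrite !inE !eqxx !orbT.
Qed.

Lemma ecc3_ge_branch_root v z : 2 < #|G| -> anc v y ->
  dep v + height z <= ecc3 v.
Proof.
move=> G3 vy; set U1 := [set u | anc u v && (u != x)].
set U2 := [set u | anc u z && ~~ anc u y].
have dU : [disjoint U1 & U2].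
  rewrite disjoint_subset; apply/subsetP=> u; rewrite !inE => /andP[uv _].
  by rewrite (anc_trans uv vy) andbF.
rewrite -(card_anc_off_root v) -/U1 /height -/U2 -card_disjointU //.
apply: (@ecc3_ge v x z) => // u; rewrite !inE => /orP[] /andP[u1 u2].
  by exists v, x; rewrite !inE !eqxx !orbT; split=> //; apply: contra u2 => /anc_of_root->.
exists z, x; rewrite !inE !eqxx !orbT; split=> //.
by apply: contra u2 => /anc_of_root->; apply: anc_root.
Qed.

(** Both ends of the path are leaves: [y] is deepest, and a neighbour of [x] off the path would have
    depth 1 and height 1, contradicting the bound on heights. *)
Lemma card_leaves_off :
  y != x -> (forall v, dep v <= dep y) -> (forall v, 2 * height v <= dep v) ->
  #|[set l in leaves G | ~~ anc l y]| + 2 <= #|leaves G|.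
Proof.
move=> yx dep_max half.
have y_leaf : y \in leaves G.
  rewrite inE; apply/cards1P; exists (par y); apply/setP=> w; rewrite !inE.
  apply/idP/eqP => [yw|->]; last exact: adj_par.
  case: (par_adj yw) => // yE.
  have wx : w != x by apply: contraTneq yw => e; rewrite yE e par_root adj_irr.
  by have := dep_max w; rewrite (dep_parS wx) -yE ltnn.
have x_leaf : x \in leaves G.
  have dx : dep x = 0 by apply/eqP; rewrite dep0.
  have dy : 0 < dep y by rewrite lt0n dep0.
  pose c := iter (dep y - 1) par y.
  have dc : dep c = 1 by rewrite dep_iter subKn.
  have cy : anc c y by rewrite /anc dc.
  have cx : par c = x by apply/eqP; rewrite -dep0 dep_par dc.
  rewrite inE; apply/cards1P; exists c; apply/setP=> w; rewrite !inE.
  apply/idP/eqP => [xw|->]; last first.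
    by rewrite adj_sym -cx adj_par // -dep0 dc.
  case: (par_adj xw) => xE; first by move: xw; rewrite xE par_root adj_irr.
  have wx : w != x by apply: contraTneq xw => ->; rewrite adj_irr.
  have dw : dep w = 1 by rewrite (dep_parS wx) -xE dx.
  apply: (anc_inj (v := y)); rewrite ?inE ?dc //.
  apply: contraT => wy; have := half w.
  by rewrite height_off // dw mulnS.
have -> : 2 = #|[set x; y]| by rewrite cards2 eq_sym yx.
rewrite -card_disjointU.
  apply/subset_leq_card/subsetP=> u; rewrite in_setU in_set2 inE => /orP[/andP[]//|].
  by case/orP=> /eqP->.
rewrite disjoint_sym disjoint_subset; apply/subsetP=> u; rewrite !inE negb_and negbK.
by case/orP=> /eqP->; rewrite ?anc_root ?anc_refl orbT.
Qed.

(** The truncated deficits [q.+1 - height v] are summed level by level: at most [b] vertices have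
    each of the deficits q, q-1, ..., 1. *)
Lemma sum_off_height q b :
  (forall k, 0 < k -> #|[set v | height v == k]| <= b) ->
  2 * (q.+1 * #|[set v | ~~ anc v y]|) <=
    2 * (\sum_(v | ~~ anc v y) height v) + b * (q * q.+1).
Proof.
move=> hb.
have H : \sum_(v | ~~ anc v y) (q.+1 - height v) <= b * \sum_(j < q.+1) (q - j).
  apply: (@leq_trans (\sum_(v | ~~ anc v y) \sum_(j < q.+1) (height v == j.+1) * (q - j))).
    apply: leq_sum => v; rewrite -height_gt0 => v0.
    case: (ltnP q (height v)) => qv; first by rewrite (eqP (_ : q.+1 - height v == 0)) // subn_eq0.
    have vq : (height v).-1 < q.+1 by lia.
    rewrite (bigD1 (Ordinal vq)) //= prednK // eqxx mul1n (leq_trans _ (leq_addr _ _)) //.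
    by lia.
  rewrite exchange_big big_distrr /=; apply: leq_sum => j _.
  rewrite -big_distrl leq_mul2r /=; apply/orP; right; apply: leq_trans (hb j.+1 isT).
  rewrite -sum1_card big_mkcond [leqRHS]big_mkcond; apply: leq_sum => v _.
  by rewrite inE; case: ifP => // _; case: eqP.
have -> : b * (q * q.+1) = 2 * (b * \sum_(j < q.+1) (q - j)).
  by rewrite [RHS]mulnCA sum_subn_ord.
rewrite -mulnDr leq_mul2l /=.
apply: leq_trans (leq_add (leqnn _) H); rewrite -big_split /= mulnC -sum_nat_const.
rewrite (eq_bigl (fun v => ~~ anc v y)) => [|v]; last by rewrite inE.
by apply: leq_sum => v _; lia.
Qed.

Lemma card_off_le h b :
  (forall v, height v <= h) ->
  (forall k, 0 < k -> #|[set v | height v == k]| <= b) ->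
  #|[set v | ~~ anc v y]| <= h * b.
Proof.
move=> hh hb.
apply: (@leq_trans (\sum_(v | ~~ anc v y) \sum_(j < h) (height v == j.+1))).
  rewrite -sum1_card (eq_bigl (fun v => ~~ anc v y)) => [|v]; last by rewrite inE.
  apply: leq_sum => v; rewrite -height_gt0 => v0.
  have vq : (height v).-1 < h by rewrite prednK.
  by rewrite (bigD1 (Ordinal vq)) //= prednK // eqxx leq_addr.
rewrite exchange_big /= -[h in leqRHS]card_ord -sum_nat_const; apply: leq_sum => j _.
apply: leq_trans (hb j.+1 isT).
rewrite -sum1_card big_mkcond [leqRHS]big_mkcond; apply: leq_sum => v _.
by rewrite inE; case: ifP => // _; case: eqP.
Qed.

Lemma sum_on_ecc3 z : 2 < #|G| -> 2 * height z <= dep y ->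
  2 * ((dep y).+1 * dep y) + 2 * (height z * (height z).+1) <=
    2 * \sum_(v | anc v y) ecc3 v.
Proof.
move=> G3 half; set h := height z; set D := dep y.
(* At depth j this is the maximum of D, D - j + h and j + h: as 2h is at most D, at most one of the
   truncated terms is positive. *)
pose F j := D + (h - j) + (h - (D - j)).
have -> : 2 * (D.+1 * D) + 2 * (h * h.+1) = 2 * \sum_(j < D.+1) F j.
  rewrite !big_split /= sum_nat_const card_ord.
  have -> : \sum_(j < D.+1) (h - (D - j)) = \sum_(j < D.+1) (h - j).
    rewrite (reindex_inj rev_ord_inj) /=; apply: eq_bigr => j _.
    by rewrite subSS subKn // -ltnS.
  rewrite -addnA addnn -mul2n mulnDr sum_subn_ord //.
  by rewrite /h /D; lia.
rewrite leq_mul2l /= -sum_anc; apply: leq_sum => v vy.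
have le := anc_dep vy.
have := ecc3_ge_diameter v G3; have := ecc3_ge_branch_y z G3 vy.
by have := ecc3_ge_branch_root z G3 vy; rewrite /F -/D -/h in le half *; lia.
Qed.

End Trunk.

End RootedTree.

(** [D] is the diameter and [h] the largest distance to a diametral path. The parameter q stays
    free, to be matched later with the shortest leg of the balanced tree. *)
Lemma tree_sum_ecc3 (G : sgraph) : is_tree G -> 2 < #|G| ->
  exists D h, [/\ 2 * h <= D, D < #|G|,
    #|G| - D.+1 <= h * (#|leaves G| - 2) & forall q,
    2 * (#|G| * D) + 2 * (h * h.+1) + 2 * (q.+1 * (#|G| - D.+1)) <=
      2 * (\sum_(v : G) ecc3 v) + (#|leaves G| - 2) * (q * q.+1)].
Proof.
move=> [/card_gt0P[r _] [Gc Gac]] G3.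
have [d [d_path d_min]] := dist_exists Gc.
have [[x y] /= _ xy_max] := @arg_maxnP _ (r, r) predT (fun u => d u.1 u.2) isT.
have d_max u v : d u v <= d x y by apply: (xy_max (u, v)).
have [par [par_root dep_par adj_par par_adj]] := tree_parent Gac (d_path x) (d_min x).
have dep0 u : (d x u == 0) = (u == x).
  apply/eqP/eqP => [e|->]; last by apply/eqP; rewrite -leqn0 (d_min x [::]).
  by have [p [_ + +]] := d_path x u; rewrite e => <- /size0nil->.
have yx : y != x.
  have [u ux] : exists u, u != x.
    apply/existsP; apply: contraLR G3; rewrite negb_exists => /forallP ux.
    rewrite -leqNgt (leq_trans _ (leqnSn 1)) // -(card1 x); apply/subset_leq_card/subsetP.
    by move=> u _; rewrite inE -[_ == _]negbK ux.
  by rewrite -dep0 -lt0n (leq_trans _ (d_max x u)) // lt0n dep0.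
pose ht := height (d x) par y.
(* A shortest path from v to y has length at most [d x y], and y has height 0. *)
have half v : 2 * ht v <= d x v.
  have [p [pP py sp]] := d_path v y; have vy := d_max v y.
  have := path_height dep0 par_root dep_par par_adj y pP.
  by rewrite py sp (height_on dep_par (anc_refl _ _ _)) -/(ht v); lia.
have [z _ z_max] := @arg_maxnP _ x predT ht isT.
set p := #|leaves G| - 2.
have off_p : #|[set l in leaves G | ~~ anc (d x) par l y]| <= p.
  have := card_leaves_off dep0 par_root dep_par adj_par par_adj yx (d_max x) half.
  by rewrite /p; lia.
have hb k : 0 < k -> #|[set v | ht v == k]| <= p.
  by move=> k0; apply: leq_trans off_p; apply: (card_level dep0).
pose On := [set v | anc (d x) par v y]; pose Off := [set v | ~~ anc (d x) par v y].
have cOn : #|On| = (d x y).+1 by rewrite (card_anc dep_par).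
have cOff : #|On| + #|Off| = #|G|.
  rewrite -(cardsC On); congr (_ + _); apply: eq_card => v; by rewrite !inE.
have cOff' : #|G| - (d x y).+1 = #|Off| by rewrite -cOff cOn addKn.
exists (d x y), (ht z); split.
- exact: leq_trans (half z) (d_max _ _).
- by rewrite -cOff cOn leq_addr.
- by rewrite cOff'; apply: (card_off_le dep0) => // v; apply: z_max.
move=> q; rewrite cOff'.
have := sum_off_height dep0 par_root dep_par q hb.
rewrite -/Off => H1.
have H2 : 2 * ((d x y).+1 * d x y) + 2 * (ht z * (ht z).+1) <=
    2 * \sum_(v | anc (d x) par v y) ecc3 v.
  by apply: (sum_on_ecc3 Gc dep0) => //; apply: leq_trans (half z) (d_max _ _).
have H3 : #|Off| * d x y + \sum_(v | ~~ anc (d x) par v y) ht v <=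
    \sum_(v | ~~ anc (d x) par v y) ecc3 v.
  rewrite -sum_nat_const (eq_bigl (fun v => ~~ anc (d x) par v y)) => [|v]; last by rewrite inE.
  by rewrite -big_split; apply: leq_sum => v _; apply: (ecc3_ge_diameter Gc dep0).
rewrite (bigID (fun v => anc (d x) par v y)) /= -cOff cOn.
move: H1 H2 H3; move: (d x y) (ht z) #|Off| (\sum_(v | _) ht v) => D h o s1.
move: (\sum_(v | _) _) (\sum_(v | _) _) => s2 s3; nia.
Qed.

(** * Upper bound for balanced starlike trees *)

Section Spider.

Variables (t : nat) (l : 'I_t -> nat).

Definition sdep (x : spider l) : nat := if x is Some u then (tagged u).+1 else 0.

Definition spar (x : spider l) : spider l :=
  if x is Some u then
    if tagged u == 0 :> nat then None
    else Some (Tagged (fun i => 'I_(l i))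
           (Ordinal (leq_ltn_trans (leq_pred (tagged u)) (ltn_ord (tagged u)))))
  else None.

Lemma sdep_spar (x : spider l) : x != None :> spider l -> (sdep (spar x)).+1 = sdep x.
Proof. by case: x => [[i [[|j] h]]|] //=; rewrite eqxx. Qed.

Lemma adj_spar (x : spider l) : x != None :> spider l -> adj x (spar x).
Proof. by case: x => [[i [[|j] h]]|] //= _; rewrite !eqxx orbT. Qed.

(** The first k vertices of leg i. The centre is left out so that vertices count edges towards
    it. *)
Definition seg (i : 'I_t) (k : nat) : {set spider l} :=
  [set x : spider l | if x is Some u then (tag u == i) && (tagged u < k) else false].

Lemma card_seg i k : #|seg i k| <= k.
Proof.
pose s := [set o : 'I_(l i) | o < k].
have -> : seg i k = [set (Some (Tagged (fun i => 'I_(l i)) o) : spider l) | o in s].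
  apply/setP=> x; rewrite inE; apply/idP/imsetP => [|[o]]; last first.
    by rewrite inE => ok -> /=; rewrite eqxx.
  case: x => [[i' o] /= /andP[/eqP e ok]|//]; subst i'.
  by exists o; rewrite ?inE.
apply: leq_trans (leq_imset_card _ _) _.
rewrite cardE -(size_map val) -[leqRHS](size_iota 0); apply: uniq_leq_size.
  by rewrite map_inj_uniq ?enum_uniq //; apply: val_inj.
by move=> _ /mapP[o + ->]; rewrite mem_enum inE mem_iota.
Qed.

(** Closure under parents, up to the centre: together with the centre, [U] spans a subtree with
    [#|U|] edges. *)
Definition rooted (U : {set spider l}) :=
  forall u, u \in U -> u != None :> spider l /\ spar u \in (None : spider l) |: U.

Lemma rooted_seg i k : rooted (seg i k).
Proof.
move=> [[i' [j h]]|]; rewrite !inE //= => /andP[/eqP e jk]; subst i'; split=> //.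
case: j h jk => [|j] h jk //=.
by rewrite eqxx /= ltnW.
Qed.

Lemma rootedU U V : rooted U -> rooted V -> rooted (U :|: V).
Proof.
move=> hU hV u; rewrite inE => /orP[/hU|/hV] [u0]; rewrite !inE => /orP[]->;
  by rewrite ?orbT.
Qed.

(** * Eccentricities in a spider with leg lengths q and q+1 *)

Section Iso.

Variables (G : sgraph) (f : G -> spider l).
Hypothesis f_bij : bijective f.
Hypothesis f_adj : forall x y, adj (f x) (f y) = adj x y.

Lemma steiner_dist_spider (S : {set G}) U :
  rooted U -> (forall s, s \in S -> f s \in (None : spider l) |: U) -> steiner_dist S <= #|U|.
Proof.
have [g fg gf] := f_bij; move=> hU SU.
have -> : #|U| = #|f @^-1: U| by rewrite on_card_preimset //; apply: onW_bij.
apply: (@steiner_dist_le _ (g None) (fun v => g (spar (f v))) (sdep \o f)) => [u|].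
  rewrite inE => /hU[u0]; rewrite !inE => pU; split.
  - by rewrite -f_adj gf; apply: adj_spar.
  - by rewrite /= gf (can_eq gf).
  by rewrite /= gf -(sdep_spar u0).
by apply/subsetP=> s /SU; rewrite !inE -(inj_eq (bij_inj f_bij)) gf.
Qed.

Hypothesis t3 : 2 < t.
Variable q : nat.
Hypothesis l_q : forall i, l i = q \/ l i = q.+1.

Let long i : nat := l i == q.+1.
Let r := #|[set i | l i == q.+1]|.

Lemma third_leg (i j : 'I_t) : exists k, (k != i) && (k != j).
Proof.
have /set0Pn[k] : ~: [set i; j] != set0.
  rewrite -card_gt0 cardsCs setCK card_ord subn_gt0 (leq_ltn_trans _ t3) //.
  by rewrite cards2; case: (i != j).
by rewrite !inE negb_or; exists k.
Qed.

Lemma other_leg (i j : 'I_t) : exists2 k, k != i & (j == i) || (j == k).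
Proof.
have [->|ji] := eqVneq j i; last by exists j; rewrite ?eqxx.
by have [k /andP[ki _]] := third_leg i i; exists k.
Qed.

Lemma other_leg2 (i a b : 'I_t) : a != i -> b != i ->
  exists k, [&& k != i, k != a & (b == a) || (b == k)].
Proof.
move=> ai bi; have [->|ba] := eqVneq b a; last by exists b; rewrite bi ba eqxx.
by have [k /andP[ki ka]] := third_leg i a; exists k; rewrite ki ka.
Qed.

Lemma leg_length i : l i = q + long i.
Proof. by rewrite /long; case: (l_q i) => ->; rewrite ?eqxx ?addn1 // ltn_eqF ?addn0. Qed.

Lemma sum_two_legs a b : a != b -> l a + l b <= 2 * q + minn 2 r.
Proof.
move=> ab; rewrite !leg_length; suff : long a + long b <= r.
  by rewrite /long; case: eqP; case: eqP => /=; lia.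
rewrite eq_sym in ab; rewrite /r (cardsD1 a) (cardsD1 b) !inE ab /= addnA.
exact: leq_addr.
Qed.

Lemma sum_two_other_legs i a b : a != i -> b != i -> a != b ->
  l a + l b <= 2 * q + minn 2 (r - long i).
Proof.
move=> ai bi ab; rewrite !leg_length; suff : long a + long b + long i <= r.
  by rewrite /long; case: eqP; case: eqP; case: eqP => /=; lia.
rewrite eq_sym in ab; rewrite /r (cardsD1 i) (cardsD1 a) (cardsD1 b) !inE ai bi ab /=.
by rewrite /long; lia.
Qed.

(** The centre belongs to any leg, so an arbitrary default i can be assigned to it. *)
Let leg (i : 'I_t) (x : spider l) : 'I_t := if x is Some u then tag u else i.

Lemma mem_leg i x k : leg i x == k -> x \in (None : spider l) |: seg k (l k).
Proof.
by case: x => [[i' j]|]; rewrite !inE //= => /eqP<-; rewrite eqxx ltn_ord.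
Qed.

(** The depth of x plus the two longest legs other than its own; for the centre, the two longest
    legs of all. *)
Definition ecc_bound (x : spider l) : nat :=
  if x is Some u then (tagged u).+1 + (2 * q + minn 2 (r - long (tag u)))
  else 2 * q + minn 2 r.

(** The triple is covered by initial segments of legs. When a and b avoid the leg of v, the segment
    up to v and two other legs suffice; otherwise that whole leg and one other do. *)
Lemma steiner_dist_spider_le v a b :
  steiner_dist [set v; a; b] <= ecc_bound (f v).
Proof.
have t0 : 0 < t by apply: ltn_trans t3.
have in_union (x : spider l) U V :
    (x \in (None : spider l) |: U) || (x \in (None : spider l) |: V) ->
    x \in (None : spider l) |: (U :|: V).
  by rewrite !inE; case: (x == None) => //=; case: (x \in U).
have cover U : rooted U -> f v \in (None : spider l) |: U ->
    f a \in (None : spider l) |: U -> f b \in (None : spider l) |: U ->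
    steiner_dist [set v; a; b] <= #|U|.
  move=> hU vU aU bU; apply: steiner_dist_spider => // s.
  by rewrite in_setU in_set2 in_set1 => /orP[/orP[]|] /eqP->.
have two i j k m : #|seg i k :|: seg j m| <= k + m.
  by apply: leq_trans (leq_card_setU _ _) (leq_add _ _); apply: card_seg.
case ev: (f v) => [u|] /=; last first.
  set i := Ordinal t0; set la := leg i (f a); set lb := leg i (f b).
  have [k ka kb] := other_leg la lb.
  rewrite eq_sym in ka; apply: leq_trans (leq_trans (two la k _ _) (sum_two_legs ka)).
  apply: cover; first by apply: rootedU; apply: rooted_seg.
  - by rewrite ev !inE.
  - by apply/in_union; rewrite (@mem_leg i (f a) la) ?eqxx.
  by apply/in_union; case/orP: kb => kb; rewrite (mem_leg kb) ?orbT.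
set i := tag u; set la := leg i (f a); set lb := leg i (f b).
have same x y : leg i x == i -> exists U, [/\ rooted U, f v \in (None : spider l) |: U,
     x \in (None : spider l) |: U, y \in (None : spider l) |: U &
     #|U| <= (tagged u).+1 + (2 * q + minn 2 (r - long i))].
  move=> xi; have [k ki yk] := other_leg i (leg i y).
  have [m /andP[mi mk]] := third_leg i k.
  exists (seg i (l i) :|: seg k (l k)); split.
  - by apply: rootedU; apply: rooted_seg.
  - by apply/in_union; rewrite ev (@mem_leg i _ i) ?eqxx.
  - by apply/in_union; rewrite (mem_leg xi).
  - by apply/in_union; case/orP: yk => yk; rewrite (mem_leg yk) ?orbT.
  apply: leq_trans (two _ _ _ _) _; have := sum_two_other_legs mi ki mk.
  (* Exchanging the whole leg i for a third leg m loses at most one edge, and the depth of v, at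
     least 1, makes up for it. *)
  have : l i <= (l m).+1 by have := l_q i; have := l_q m; lia.
  by lia.
have [ai|ai] := boolP (la == i).
  have [U [hU vU aU bU cU]] := same (f a) (f b) ai.
  by apply: leq_trans cU; apply: cover.
have [bi|bi] := boolP (lb == i).
  have [U [hU vU aU bU cU]] := same (f b) (f a) bi.
  by apply: leq_trans cU; apply: cover.
have [k /and3P[ki ka bk]] := other_leg2 ai bi.
rewrite eq_sym in ka.
apply: (@leq_trans #|seg i (tagged u).+1 :|: (seg la (l la) :|: seg k (l k))|).
  apply: cover.
  - by do !apply: rootedU; apply: rooted_seg.
  - by rewrite ev !inE /= eqxx ltnSn.
  - by apply/in_union/orP; right; apply/in_union; rewrite (@mem_leg i (f a) la) ?eqxx.
  apply/in_union/orP; right; apply/in_union.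
  by case/orP: bk => bk; rewrite (mem_leg bk) ?orbT.
apply: leq_trans (leq_card_setU _ _) (leq_add (card_seg _ _) _).
exact: leq_trans (two _ _ _ _) (sum_two_other_legs ai ki ka).
Qed.

Lemma ecc3_spider_le v : ecc3 v <= ecc_bound (f v).
Proof.
apply/bigmax_leqP => S /andP[vS /eqP cS].
have /cards2P[a [b [_ e]]] : #|S :\ v| == 2.
  by have := cardsD1 v S; rewrite vS cS add1n => -[<-].
have -> : S = [set v; a; b] by rewrite -setUA -e setD1K.
exact: steiner_dist_spider_le.
Qed.

(** The three summands come from the centre, the r legs of length q+1, each seeing r-1 other long
    legs, and the t-r legs of length q, each seeing all r. *)
Lemma sum_ecc_bound : 2 * (\sum_x ecc_bound x) =
  2 * (2 * q + minn 2 r) +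
  r * (q.+1 * q.+2 + 2 * (q.+1 * (2 * q + minn 2 r.-1))) +
  (t - r) * (q * q.+1 + 2 * (q * (2 * q + minn 2 r))).
Proof.
have -> : \sum_x ecc_bound x = ecc_bound None +
    \sum_(u : {i : 'I_t & 'I_(l i)}) ecc_bound (Some u).
  (* The enumeration of an option type starts with [None], which splits off the centre. *)
  by rewrite ![index_enum _]unlock [@Finite.enum in LHS]unlock /= big_cons big_map.
rewrite -(sig_big_dep (fun=> true) (fun _ _ => true)
   (fun i (j : 'I_(l i)) => j.+1 + (2 * q + minn 2 (r - long i)))) /=.
have leg_sum m c : 2 * (\sum_(j < m) (j.+1 + c)) = m * m.+1 + 2 * (m * c).
  by elim: m => [|m IHm]; rewrite ?big_ord0 // big_ord_recr /= mulnDr IHm; lia.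
rewrite mulnDr -addnA big_distrr /=; congr (_ + _).
under eq_bigr do rewrite leg_sum.
rewrite (bigID (fun i => l i == q.+1)) /=; congr (_ + _).
  rewrite (eq_bigr (fun=> q.+1 * q.+2 + 2 * (q.+1 * (2 * q + minn 2 r.-1)))); last first.
    by move=> i li; rewrite /long li (eqP li) subn1.
  rewrite sum_nat_const; congr (_ * _); apply: eq_card => i; by rewrite !inE.
rewrite (eq_bigr (fun=> q * q.+1 + 2 * (q * (2 * q + minn 2 r)))); last first.
  move=> i li; rewrite /long (negbTE li) subn0.
  by case: (l_q i) li => ->; rewrite ?eqxx.
rewrite sum_nat_const; congr (_ * _).
rewrite -[X in X - _]card_ord /r -(cardsC [set i | l i == q.+1]) addKn.
by apply: eq_card => i; rewrite !inE.
Qed.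

Lemma sum_ecc3_spider : 2 * (\sum_(v : G) ecc3 v) <=
  2 * (2 * q + minn 2 r) +
  r * (q.+1 * q.+2 + 2 * (q.+1 * (2 * q + minn 2 r.-1))) +
  (t - r) * (q * q.+1 + 2 * (q * (2 * q + minn 2 r))).
Proof.
rewrite -sum_ecc_bound leq_mul2l /=.
rewrite [leqRHS](reindex f) /=; last exact: onW_bij.
by apply: leq_sum => v _; apply: ecc3_spider_le.
Qed.



End Iso.

End Spider.

Lemma card_leaves_iso (G H : sgraph) (f : G -> H) :
  bijective f -> (forall x y, adj (f x) (f y) = adj x y) ->
  #|leaves G| = #|leaves H|.
Proof.
move=> f_bij f_adj; have f_inj := bij_inj f_bij.
have deg x : degree (f x) = degree x.
  rewrite /degree -(card_imset _ f_inj); apply: eq_card => w; rewrite inE.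
  have [g fg gf] := f_bij; rewrite -[w]gf f_adj mem_imset //.
  by rewrite inE.
rewrite -(on_card_preimset (onW_bij _ f_bij)); apply: eq_card => x.
by rewrite !inE deg.
Qed.

Lemma balanced_starlike_sum_ecc3 (G : sgraph) : balanced_starlike G ->
  exists q r, [/\ 0 < q, r < #|leaves G|, #|G| = (#|leaves G| * q + r).+1 &
    2 * (\sum_(v : G) ecc3 v) <=
      2 * (2 * q + minn 2 r) +
      r * (q.+1 * q.+2 + 2 * (q.+1 * (2 * q + minn 2 r.-1))) +
      (#|leaves G| - r) * (q * q.+1 + 2 * (q * (2 * q + minn 2 r)))].
Proof.
move=> [t [l [t3 l0 l_bal [f f_bij f_adj]]]].
rewrite (card_leaves_iso f_bij f_adj) card_leaves_spider //.
have -> : #|G| = #|spider l| by apply: bij_eq_card f_bij.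
have t0 : 0 < t by apply: ltn_trans t3.
have [i0 _ i0_min] := @arg_minnP _ (Ordinal t0) predT l isT.
have l_q i : l i = l i0 \/ l i = (l i0).+1.
  by have := l_bal i i0; have := i0_min i isT; lia.
(* The shortest length and the number of longer legs; leg i0 is not among these, whence r < p. *)
exists (l i0), #|[set i | l i == (l i0).+1]|; split=> //.
- rewrite -[ltnRHS](card_ord t) -cardsT; apply: proper_card; apply/properP.
  by split; [apply: subsetT | exists i0; rewrite ?inE // ltn_eqF].
- rewrite card_spider; congr _.+1.
  rewrite (eq_bigr (fun i => l i0 + (l i == (l i0).+1))) => [|i _]; last first.
    by case: (l_q i) => ->; rewrite ?eqxx ?addn1 // ltn_eqF ?addn0.
  rewrite big_split /= sum_nat_const card_ord; congr (_ + _).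
  by rewrite -sum1_card [RHS]big_mkcond; apply: eq_bigr => i _; rewrite inE; case: eqP.
exact: (sum_ecc3_spider f_bij f_adj).
Qed.

(** * Comparison of the bounds *)

(** The left side equals the right side at the values of D, h and o in the balanced tree. Passing to
    a larger diameter D + e moves e vertices off the branches, and the gain from the diameter term
    outweighs the losses in the other two. *)
Lemma sum_ecc3_bounds p q r D h o :
  2 < p -> 0 < q -> r < p -> 2 * h <= D -> D + o = p * q + r ->
  o <= h * (p - 2) ->
  2 * (2 * q + minn 2 r) +
  r * (q.+1 * q.+2 + 2 * (q.+1 * (2 * q + minn 2 r.-1))) +
  (p - r) * (q * q.+1 + 2 * (q * (2 * q + minn 2 r))) + (p - 2) * (q * q.+1) <=
  2 * ((p * q + r).+1 * D) + 2 * (h * h.+1) + 2 * (q.+1 * o).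
Proof.
move=> p3 q0 rp hD Do oh.
(* In the balanced tree: the two longest legs together, the third longest leg, and the number of
   vertices off the two longest. *)
pose D0 := 2 * q + minn 2 r; pose h0 := q + (2 < r); pose o0 := p * q + r - D0.
have o0E : o0 = (p - 2) * q + (r - 2).
  rewrite /o0 /D0; have [p' ->] : exists p', p = p' + 2 by exists (p - 2); lia.
  rewrite addnK; lia.
have D0o0 : D0 + o0 = p * q + r.
  rewrite o0E /D0; have [p' ->] : exists p', p = p' + 2 by exists (p - 2); lia.
  rewrite addnK; lia.
have -> : 2 * (2 * q + minn 2 r) +
  r * (q.+1 * q.+2 + 2 * (q.+1 * (2 * q + minn 2 r.-1))) +
  (p - r) * (q * q.+1 + 2 * (q * (2 * q + minn 2 r))) + (p - 2) * (q * q.+1) =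
  2 * ((p * q + r).+1 * D0) + 2 * (h0 * h0.+1) + 2 * (q.+1 * o0).
  rewrite o0E /D0 /h0; case: r rp {Do D0 h0 o0 o0E D0o0} => [|[|[|r]]] rp /=.
  - rewrite !minn0 !addn0 !subn0; have [p' ->] : exists p', p = p' + 2 by exists (p - 2); lia.
    rewrite addnK; nia.
  - have [p' ->] : exists p', p = p' + 2 by exists (p - 2); lia.
    have -> : p' + 2 - 1 = p' + 1 by lia. rewrite addnK /minn /=; nia.
  - have [p' ->] : exists p', p = p' + 2 by exists (p - 2); lia.
    rewrite addnK /minn /=; nia.
  have [s ->] : exists s, p = s + r.+3 by exists (p - r.+3); lia.
  have -> : s + r.+3 - 2 = s + r.+1 by lia.
  have -> : r.+3 - 2 = r.+1 by lia.
  have [-> ->] : minn 2 r.+3 = 2 /\ minn 2 r.+2 = 2 by split; lia.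
  rewrite addnK addn1; lia.
have [p' pE] : exists p', p = p' + 3 by exists (p - 3); lia.
have p2E : p - 2 = p'.+1 by rewrite pE; lia.
rewrite p2E in oh o0E.
(* A smaller D would force h to be at most q, hence o at most q(p-2), hence D at least 2q + r after
   all. *)
have DD0 : D0 <= D.
  rewrite leqNgt; apply/negP=> lt.
  have hq : h <= q by rewrite /D0 in lt; lia.
  have : h * p'.+1 <= q * p'.+1 by rewrite leq_mul2r hq orbT.
  rewrite /D0 in lt; rewrite pE in Do; lia.
pose e := D - D0.
have DE : D = D0 + e by rewrite subnKC.
have oE : o0 = o + e by lia.
(* Otherwise at most [h * (p - 2) + e] vertices would be available for the [o0] required. *)
have h_ge : h0 <= h + e.
  rewrite leqNgt; apply/negP=> lt.
  have : (h + e.+1) * p'.+1 <= h0 * p'.+1 by rewrite leq_mul2r addnS lt orbT.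
  rewrite /h0; case: ltnP => r2; nia.
have n_ge : q.+1 + 2 * h0 <= (p * q + r).+1.
  by rewrite pE /h0; case: ltnP => r2; nia.
(* With c = h0 - h > 0, the difference of the two products is c(h + h0 + 1), at most 2 h0 c, and c
   is at most e. *)
have T_ge : h0 * h0.+1 <= h * h.+1 + 2 * (h0 * e).
  case: (leqP h0 h) => hh; first by apply: leq_trans (leq_addr _ _); apply: leq_mul.
  have [c c0 cE] : exists2 c, 0 < c & h0 = h + c by exists (h0 - h); lia.
  have ce : c <= e by lia.
  have : (h + c) * c <= (h + c) * e by rewrite leq_mul2l ce orbT.
  rewrite cE; nia.
have : (q.+1 + 2 * h0) * e <= (p * q + r).+1 * e by rewrite leq_mul2r n_ge orbT.
rewrite DE oE; move: (p * q + r).+1 T_ge => m; nia.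
Qed.

Theorem theorem5p3 (n p : nat) (T B : sgraph)
    (hn : 2 <= n) (hp : 3 <= p)
    (hT : is_tree T) (hTn : #|T| = n) (hTp : #|leaves T| = p)
    (hB : is_BS n p B) :
  (aecc3 B <= aecc3 T)%R.
Proof.
have [B_bal Bn Bp] := hB; subst n.
rewrite /aecc3 Bn -!natr_sum.
have T3 : 2 < #|T| by apply: leq_trans hp _; rewrite -hTp max_card.
rewrite ler_pM2r ?invr_gt0 ?ltr0n; last exact: leq_trans T3.
rewrite ler_nat.
(* The quotient and remainder of n - 1 by p, read off from B, also fix the free parameter in the
   bound for T. *)
have [q [r [q0 rp Bcard B_le]]] := balanced_starlike_sum_ecc3 B_bal.
have [D [h [hD D_lt off_le /(_ q) T_ge]]] := tree_sum_ecc3 hT T3.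
rewrite Bp in rp Bcard B_le; rewrite hTp in off_le T_ge.
rewrite -Bn Bcard in off_le T_ge D_lt.
have Do : D + ((p * q + r).+1 - D.+1) = p * q + r by rewrite subSS subnKC.
have bounds := sum_ecc3_bounds hp q0 rp hD Do off_le.
(* Doubling clears the halves, and adding [(p - 2) * (q * q.+1)] to both sides matches the
   correction term in the bound for T. *)
by rewrite -(leq_pmul2l (m := 2)) // -(leq_add2r ((p - 2) * (q * q.+1)));
  apply: leq_trans T_ge; apply: leq_trans bounds; rewrite leq_add2r.
Qed.
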